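(* Let $G$ be a finite group, let $(\{\mathfrak{S}^{A}\}_A,\{\mathfrak{O}^{A\to B}\}_{A,B})$ be a resource theory satisfying tensor closure, ancilla preparation, closure under discarding and convexity, and compatible with the symmetry $(G,\{U^A\}_A)$. Let $K$ be a subgroup of $G$, let $\epsilon\in[0,1)$, and let $\rho$ be a state on a system $A$ such that there exists a control-admissible sub-POVM $\{M_x\}_{x\in G/K}$ on $A$ with $$\frac{1}{|G|}\sum_{g\in G}\mathrm{tr}\big(M_{gK}\,\mathcal{U}_g(\rho)\big)\ge 1-\epsilon .$$ Let $\mathcal{E}\in\mathfrak{O}^{X\to Y}$ be a free operation that is $K$-covariant, and let $\Delta$ be a distinguishability measure with orthogonal distinguishability function $f_\Delta$. Then there exists a $G$-covariant free operation $\mathcal{F}\in\mathfrak{O}^{AX\to Y}$ such that for every state $\chi$ on $X$, $$\Delta\big(\mathcal{E}(\chi),\mathcal{F}(\rho\otimes\chi)\big)\le f_\Delta(-\log(1-\epsilon)).$$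
   Context: All systems are finite-dimensional. A resource theory consists of, for each system $A$, a set $\mathfrak{S}^A$ of (free) states and, for each pair of systems, a set $\mathfrak{O}^{A\to B}$ of (free) CPTP maps such that free operations map free states to free states, identity channels are free, and compositions of free operations are free. Further standing assumptions: (tensor closure) tensor products of free states are free and tensor products of free operations are free; (ancilla preparation) for every $\sigma\in\mathfrak{S}^X$ the map $\rho\mapsto\rho\otimes\sigma$ is in $\mathfrak{O}^{A\to AX}$; (closure under discarding) $\mathrm{tr}_X\in\mathfrak{O}^{AX\to A}$; (convexity) each $\mathfrak{O}^{A\to B}$ is convex. Every system $A$ carries a projective unitary representation $U^A$ of $G$, with $\mathcal{U}^A_g(\cdot)=U^A(g)\cdot U^A(g)^\dagger$ (superscript often omitted); composite systems carry tensor-product representations. The theory is compatible with the symmetry if $\mathcal{U}^A_g(\mathfrak{S}^A)=\mathfrak{S}^A$ and $\mathcal{U}^B_g\circ\mathfrak{O}^{A\to B}\circ\mathcal{U}^A_{g^{-1}}=\mathfrak{O}^{A\to B}$ for all $g\in G$ and all $A,B$. For a subgroup $T\subset G$, $\mathcal{E}:A\to B$ is $T$-covariant if $\mathcal{E}\circ\mathcal{U}^A_g=\mathcal{U}^B_g\circ\mathcal{E}$ for all $g\in T$. A sub-POVM is a finite family of positive semidefinite operators $\{M_x\}_{x\in X_0}$ with $\sum_xM_x\le I$; put $M_\perp:=I-\sum_{x}M_x$. A sub-POVM on $A$ is control-admissible if for all systems $B,C$ and all free operations $\mathcal{E}_x\in\mathfrak{O}^{B\to C}$, $x\in X_0\cup\{\perp\}$,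 the map $L\mapsto\sum_{x\in X_0\cup\{\perp\}}\mathcal{E}_x(\mathrm{tr}_A((M_x\otimes I_B)L))$ is in $\mathfrak{O}^{AB\to C}$. A distinguishability measure $\Delta$ is a family of functions $\Delta_{\mathcal{H}}$ on pairs of states of each finite-dimensional $\mathcal{H}$, with values in $[0,\infty]$, such that $\Delta(\rho,\sigma)\ge\Delta(\mathcal{E}(\rho),\mathcal{E}(\sigma))$ for all CPTP maps $\mathcal{E}$. Its orthogonal distinguishability function is $f_\Delta(x):=\Delta(\rho_0,e^{-x}\rho_0+(1-e^{-x})\sigma_0)$, $x\in[0,\infty]$, for any pair of orthogonal states $\rho_0,\sigma_0$ (independent of the choice). *)

(* Defs.v *)
From mathcomp Require Import all_boot all_order all_algebra all_fingroup.
From mathcomp Require Import all_classical all_reals all_analysis.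
From mathcomp Require Import complex mxtens.

Set Implicit Arguments.
Unset Strict Implicit.
Unset Printing Implicit Defensive.

Import Order.TTheory GRing.Theory Num.Theory.
Local Open Scope classical_set_scope.
Local Open Scope ring_scope.
Local Open Scope complex_scope.
Local Open Scope sesquilinear_scope.

(* Operators on C^m are 'M[R[i]]_m with R a realType, and C^m (x) C^p is
   C^(m * p) through the basis bijection mxtens_index, so that the tensor
   product of operators is the Kronecker product tensmx, written *t. *)
Section Operators.
Variable R : realType.
Local Notation C := R[i].

(* Over C, nonnegativity of the quadratic form implies that M is Hermitian. *)
Definition psd n (M : 'M[C]_n) : Prop :=
  forall v : 'cV[C]_n, 0 <= (v^t* *m M *m v) 0 0.

Definition state n (rho : 'M[C]_n) : Prop := psd rho /\ \tr rho = 1.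

Definition orthogonal_states n (rho sigma : 'M[C]_n) : Prop :=
  [/\ state rho, state sigma & rho *m sigma = 0].

(* For linear E and F, the linear extension of M *t N |-> E M *t F N. *)
Definition tensmap m m' p p' (E : 'M[C]_m -> 'M[C]_m')
    (F : 'M[C]_p -> 'M[C]_p') (L : 'M[C]_(m * p)) : 'M[C]_(m' * p') :=
  \sum_(i < m) \sum_(j < m) \sum_(k < p) \sum_(l < p)
    L (mxtens_index (i, k)) (mxtens_index (j, l)) *:
      (E (delta_mx i j) *t F (delta_mx k l)).

Definition completely_positive m n (E : 'M[C]_m -> 'M[C]_n) : Prop :=
  forall (k : nat) (L : 'M[C]_(k * m)),
    psd L -> psd (tensmap (fun M : 'M[C]_k => M) E L).

Definition cptp m n (E : 'M[C]_m -> 'M[C]_n) : Prop :=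
  [/\ linear E, completely_positive E & forall L, \tr (E L) = \tr L].

Definition ptrace1 m p (L : 'M[C]_(m * p)) : 'M[C]_p :=
  \matrix_(i, j) \sum_(k < m) L (mxtens_index (k, i)) (mxtens_index (k, j)).

Definition ptrace2 m p (L : 'M[C]_(m * p)) : 'M[C]_m :=
  \matrix_(i, j) \sum_(k < p) L (mxtens_index (i, k)) (mxtens_index (j, k)).

Definition sub_povm (I : finType) n (X0 : {set I}) (M : I -> 'M[C]_n) : Prop :=
  (forall x, x \in X0 -> psd (M x)) /\ psd (1%:M - \sum_(x in X0) M x).

(* Only the values on states are meaningful. *)
Definition distinguishability_measure
    (Delta : forall n, 'M[C]_n -> 'M[C]_n -> \bar R) : Prop :=
  (forall n (rho sigma : 'M[C]_n), state rho -> state sigma ->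
     (0 <= Delta n rho sigma)%E) /\
  (forall m n (E : 'M[C]_m -> 'M[C]_n) (rho sigma : 'M[C]_m),
     cptp E -> state rho -> state sigma ->
     (Delta n (E rho) (E sigma) <= Delta m rho sigma)%E).

(* The orthogonal distinguishability function of Delta, computed from the pair
   of orthogonal states (rho0, sigma0), for x in [0, +oo]; expeR -oo = 0. *)
Definition orth_dist (Delta : forall n, 'M[C]_n -> 'M[C]_n -> \bar R)
    n (rho0 sigma0 : 'M[C]_n) (x : \bar R) : \bar R :=
  let p := (fine (expeR (- x)%E))%:C in
  Delta n rho0 (p *: rho0 + (1 - p) *: sigma0).

End Operators.

(* Systems are labels carrying a Hilbert space C^(hdim A), so that different
   systems may have the same Hilbert space. *)
Record systems := Systems {
  system :> Type;
  hdim : system -> nat;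
  composite : system -> system -> system;
  hdim_composite : forall A B, hdim (composite A B) = (hdim A * hdim B)%N }.

Section ResourceTheory.
Variables (R : realType) (S : systems).
Local Notation C := R[i].

Definition op (A : S) := 'M[C]_(hdim A).

Definition to_tens (A B : S) (L : op (composite A B)) :
    'M[C]_(hdim A * hdim B) :=
  castmx (hdim_composite A B, hdim_composite A B) L.

Definition of_tens (A B : S) (L : 'M[C]_(hdim A * hdim B)) :
    op (composite A B) :=
  castmx (esym (hdim_composite A B), esym (hdim_composite A B)) L.

Definition tens (A B : S) (M : op A) (N : op B) : op (composite A B) :=
  of_tens (M *t N).

Definition tens_map (A A' B B' : S) (E : op A -> op A') (F : op B -> op B') :
    op (composite A B) -> op (composite A' B') :=
  fun L => of_tens (tensmap E F (to_tens L)).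

Definition ptr1 (A B : S) (L : op (composite A B)) : op B :=
  ptrace1 (to_tens L).

Definition ptr2 (A B : S) (L : op (composite A B)) : op A :=
  ptrace2 (to_tens L).

Record resource_theory := ResourceTheory {
  free_state : forall A : S, set (op A);
  free_op : forall A B : S, set (op A -> op B);
  free_stateP : forall A (sigma : op A), free_state sigma -> state sigma;
  free_opP : forall A B (E : op A -> op B), free_op E -> cptp E;
  free_op_state : forall A B (E : op A -> op B) (sigma : op A),
    free_op E -> free_state sigma -> free_state (E sigma);
  free_op_id : forall A, @free_op A A (fun L => L);
  free_op_comp : forall A B D (E : op A -> op B) (F : op B -> op D),
    free_op E -> free_op F -> free_op (F \o E) }.

Arguments free_state r A _ : clear implicits.
Arguments free_op r A B _ : clear implicits.

Definition tensor_closed (T : resource_theory) : Prop :=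
  (forall A B (sigma : op A) (tau : op B),
     free_state T A sigma -> free_state T B tau ->
     free_state T (composite A B) (tens sigma tau)) /\
  (forall A A' B B' (E : op A -> op A') (F : op B -> op B'),
     free_op T A A' E -> free_op T B B' F ->
     free_op T (composite A B) (composite A' B') (tens_map E F)).

Definition ancilla_preparation (T : resource_theory) : Prop :=
  forall A X (sigma : op X), free_state T X sigma ->
    free_op T A (composite A X) (fun rho => tens rho sigma).

Definition closed_under_discarding (T : resource_theory) : Prop :=
  forall A X, free_op T (composite A X) A (@ptr2 A X).

Definition convex_free_op (T : resource_theory) : Prop :=
  forall A B (E F : op A -> op B) (t : R), 0 <= t <= 1 ->
    free_op T A B E -> free_op T A B F ->
    free_op T A B (fun L => t%:C *: E L + (1 - t)%:C *: F L).

Definition control_admissible (T : resource_theory) (A : S) (I : finType)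
    (X0 : {set I}) (M : I -> op A) : Prop :=
  forall (B D : S) (E : I -> op B -> op D) (Ebot : op B -> op D),
    (forall x, x \in X0 -> free_op T B D (E x)) -> free_op T B D Ebot ->
    free_op T (composite A B) D (fun L =>
      \sum_(x in X0) E x (ptr1 (tens (M x) 1%:M *m L)) +
      Ebot (ptr1 (tens (1%:M - \sum_(x in X0) M x) 1%:M *m L))).

Section Symmetry.
Variables (gT : finGroupType) (G : {group gT}).

Record projective_symmetry := ProjectiveSymmetry {
  rep : forall A : S, gT -> op A;
  rep_unitary : forall A g, g \in G -> rep A g \is unitarymx;
  rep_projective : forall A g h, g \in G -> h \in G ->
    exists2 w : C, `|w| = 1 & rep A g *m rep A h = w *: rep A (g * h)%g;
  rep_composite : forall A B g, g \in G ->
    rep (composite A B) g = tens (rep A g) (rep B g) }.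

Definition sym_act (U : projective_symmetry) (A : S) (g : gT) (L : op A) : op A :=
  rep U A g *m L *m (rep U A g)^t*.

Definition compatible (T : resource_theory) (U : projective_symmetry) : Prop :=
  forall g, g \in G ->
    (forall A : S, sym_act U g @` free_state T A = free_state T A) /\
    (forall A B : S,
       [set sym_act U g \o E \o sym_act U g^-1%g | E in free_op T A B] =
       free_op T A B).

Definition covariant (U : projective_symmetry) (K : {group gT}) (A B : S)
    (E : op A -> op B) : Prop :=
  forall g, g \in K -> E \o sym_act U g = sym_act U g \o E.

End Symmetry.
End ResourceTheory.

Arguments free_state {R S} r A _.
Arguments free_op {R S} r A B _.

(* Main.v *)
(* Measuring [{M_x}] on [rho] guesses the coset [gK] of the unknown group element
   [g]; on outcome [x] one applies [E] conjugated by a representative of [x],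
   which does not depend on the representative since [E] is [K]-covariant.
   Twirling this controlled free operation over [G] gives a [G]-covariant free
   [F]. A correct guess produces exactly [E chi], so [F (rho (x) chi)] is a
   mixture [(1 - epsilon) E chi + epsilon tau]. Measuring the support of [rho0]
   and preparing [E chi] or [tau] accordingly is a channel that maps
   [(rho0, (1 - epsilon) rho0 + epsilon sigma0)] to [(E chi, F (rho (x) chi))],
   and monotonicity of [Delta] concludes. *)
From HB Require Import structures.
Require Import Defs.
From mathcomp Require Import all_boot all_order all_algebra all_fingroup.
From mathcomp Require Import all_classical all_reals all_analysis.
From mathcomp Require Import complex mxtens ring lra.

Set Implicit Arguments.
Unset Strict Implicit.
Unset Printing Implicit Defensive.

Import Order.TTheory GRing.Theory Num.Theory.
Local Open Scope classical_set_scope.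
Local Open Scope ring_scope.
Local Open Scope complex_scope.
Local Open Scope sesquilinear_scope.

(** * Positive semidefinite matrices and completely positive maps *)

Section PsdMatrices.
Variable R : realType.
Local Notation C := R[i].

Lemma adjmxM m n p (A : 'M[C]_(m, n)) (B : 'M[C]_(n, p)) :
  (A *m B)^t* = B^t* *m A^t*.
Proof. by rewrite trmx_mul map_mxM. Qed.

Lemma adjmx_tens m n p q (A : 'M[C]_(m, n)) (B : 'M[C]_(p, q)) :
  (A *t B)^t* = A^t* *t B^t*.
Proof. by rewrite trmx_tens map_mxT. Qed.

Lemma psdD n (M N : 'M[C]_n) : psd M -> psd N -> psd (M + N).
Proof.
by move=> pM pN v; rewrite mulmxDr mulmxDl mxE addr_ge0.
Qed.

Lemma psd0 n : psd (0 : 'M[C]_n).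
Proof. by move=> v; rewrite mulmx0 mul0mx mxE. Qed.

Lemma psd_sum (I : Type) (r : seq I) (P : pred I) n (F : I -> 'M[C]_n) :
  (forall i, P i -> psd (F i)) -> psd (\sum_(i <- r | P i) F i).
Proof.
by move=> pF; elim/big_ind: _ => //; [exact: psd0|exact: psdD].
Qed.

Lemma psdZ n (a : C) (M : 'M[C]_n) : 0 <= a -> psd M -> psd (a *: M).
Proof.
by move=> a0 pM v; rewrite -scalemxAr -scalemxAl mxE mulr_ge0.
Qed.

Lemma psd_conj m n (A : 'M[C]_(m, n)) (M : 'M[C]_n) :
  psd M -> psd (A *m M *m A^t*).
Proof.
by move=> pM v; have := pM (A^t* *m v); rewrite adjmxM trmxCK !mulmxA.
Qed.

Lemma psd1 n : psd (1%:M : 'M[C]_n).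
Proof.
move=> v; rewrite mulmx1 mxE sumr_ge0 // => i _.
by rewrite !mxE mulrC mul_conjC_ge0.
Qed.

Lemma psd_gram m n (B : 'M[C]_(m, n)) : psd (B *m B^t*).
Proof. by have := psd_conj B (@psd1 n); rewrite mulmx1. Qed.

Lemma psd_diag_ge0 n (M : 'M[C]_n) i : psd M -> 0 <= M i i.
Proof.
move=> /(_ (delta_mx i 0)); rewrite trmx_delta map_delta_mx.
by rewrite -rowE -colE !mxE.
Qed.

(* Polarization of the quadratic form along [e_i + a e_j] for [a = 1] and
   [a = 'i]. *)
Lemma psd_adj n (M : 'M[C]_n) : psd M -> M^t* = M.
Proof.
move=> pM; apply/matrixP => i j; rewrite !mxE.
pose w (a : C) : 'cV[C]_n := delta_mx i 0 + a *: delta_mx j 0.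
have wE (a : C) : ((w a)^t* *m M *m w a) 0 0
    = M i i + a * M i j + a^*%R * M j i + a^*%R * a * M j j.
  rewrite /w !raddfD /= !mulmxDl linearZ /= map_mxZ !trmx_delta !map_delta_mx.
  rewrite -!scalemxAr -!scalemxAl !scalerA -!rowE -!colE !mxE.
  ring.
have := pM (w 1); have := pM (w 'i); rewrite !wE.
have := psd_diag_ge0 i pM; have := psd_diag_ge0 j pM.
have -> : (M j i)^*%R = ((M j i)^*)%C by [].
have -> : ('i : C)^*%R = ('i^*)%C by [].
have -> : (1 : C)^*%R = (1^*)%C by [].
case: (M i j) (M j i) (M i i) (M j j) => a b [c d] [e f] [g h].
simpc.
move=> /andP[/eqP h0 _] /andP[/eqP f0 _] /andP[/eqP e1 _] /andP[/eqP e2 _].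
by congr (_ +i* _); lra.
Qed.

(** A psd matrix is Hermitian, hence normal, so the spectral theorem applies; the eigenvalues are
    the diagonal entries of its conjugate by [Q], which is again psd. *)
Lemma psd_spectral n (M : 'M[C]_n) : psd M ->
  exists (Q : 'M[C]_n) (d : 'rV[C]_n),
    [/\ Q *m Q^t* = 1%:M, Q^t* *m Q = 1%:M,
        M = Q^t* *m diag_mx d *m Q & forall i, 0 <= d 0 i].
Proof.
move=> pM; exists (spectralmx M), (spectral_diag M).
have uQ := spectral_unitarymx M; have /unitarymxP QQ := uQ.
have QQ' := mulmx1C QQ.
have ME : M = (spectralmx M)^t* *m diag_mx (spectral_diag M) *m spectralmx M.
  rewrite -invmx_unitary //; apply/orthomx_spectralP.
  by apply/normalmxP; rewrite psd_adj.
move: (spectralmx M) (spectral_diag M) ME QQ QQ' {uQ} => Q d ME QQ QQ'.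
split=> // i; have := psd_diag_ge0 i (psd_conj Q pM).
by rewrite ME !mulmxA QQ mul1mx -mulmxA QQ mulmx1 !mxE eqxx.
Qed.

(** Take the square roots of the eigenvalues. This Gram form reduces later positivity claims to
    [psd_gram] and [psd_conj]. *)
Lemma psd_factor n (M : 'M[C]_n) : psd M -> exists B : 'M[C]_n, M = B *m B^t*.
Proof.
move=> /psd_spectral[Q [d [_ _ -> d0]]].
exists (Q^t* *m diag_mx (\row_i sqrtC (d 0 i))).
rewrite adjmxM trmxCK !mulmxA; congr (_ *m _); rewrite -!mulmxA; congr (_ *m _).
apply/matrixP => i j; rewrite tr_diag_mx map_diag_mx mulmx_diag !mxE.
case: eqP => //= _; rewrite !mulr1n.
by rewrite conj_Creal ?ger0_real ?sqrtC_ge0 // -expr2 sqrtCK.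
Qed.

Lemma psd_tens m n (M : 'M[C]_m) (N : 'M[C]_n) : psd M -> psd N -> psd (M *t N).
Proof.
move=> /psd_factor[A ->] /psd_factor[B ->].
by rewrite -tensmx_mul -adjmx_tens; apply: psd_gram.
Qed.

(** With [N = B *m B^t*], cyclicity turns the trace into that of the psd matrix [B^t* *m M *m B]. *)
Lemma psd_trM_ge0 n (M N : 'M[C]_n) : psd M -> psd N -> 0 <= \tr (M *m N).
Proof.
move=> pM /psd_factor[B ->]; rewrite mulmxA mxtrace_mulC mulmxA.
have pBMB : psd (B^t* *m M *m B) by have := psd_conj (B^t*) pM; rewrite trmxCK.
by rewrite sumr_ge0 // => i _; apply: psd_diag_ge0.
Qed.

(** The diagonal entries of [B *m B^t*] are the squared norms of the rows of [B], so a zero trace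
    forces [B = 0]. *)
Lemma psd_tr0 n (M : 'M[C]_n) : psd M -> \tr M = 0 -> M = 0.
Proof.
move=> /psd_factor[B ->] /eqP; rewrite /mxtrace psumr_eq0; last first.
  by move=> i _; apply: psd_diag_ge0; apply: psd_gram.
move=> /allP B0; suff -> : B = 0 by rewrite mul0mx.
apply/matrixP => i j; have /= := B0 i (mem_index_enum _).
rewrite mxE psumr_eq0; last by move=> k _; rewrite !mxE mul_conjC_ge0.
move=> /allP /(_ j (mem_index_enum _)) /=.
by rewrite !mxE mul_conjC_eq0 => /eqP.
Qed.

Lemma linear_sumZ m n p q (E : 'M[C]_(m, n) -> 'M[C]_(p, q)) (I : Type)
    (r : seq I) (P : pred I) (a : I -> C) (F : I -> 'M[C]_(m, n)) :
  linear E -> E (\sum_(i <- r | P i) a i *: F i) =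
              \sum_(i <- r | P i) a i *: E (F i).
Proof.
move=> linE; have E0 : E 0 = 0.
  by have := linE (-1) 0 0; rewrite scaler0 addr0 scaleN1r addNr.
by elim/big_rec2: _ => // i y1 y2 _ <-; rewrite linE.
Qed.

Lemma linear_scale m n p q (E : 'M[C]_(m, n) -> 'M[C]_(p, q)) :
  linear E -> forall a L, E (a *: L) = a *: E L.
Proof.
move=> linE a L.
by have := linear_sumZ [:: L] xpredT (fun=> a) id linE; rewrite !big_seq1.
Qed.

(** The expansion in matrix units has the same shape as [tensmap], so the two can be compared term
    by term. *)
Lemma tensmx_sum_delta m p (L : 'M[C]_(m * p)) :
  L = \sum_(i < m) \sum_(j < m) \sum_(k < p) \sum_(l < p)
        L (mxtens_index (i, k)) (mxtens_index (j, l)) *: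
          (delta_mx i j *t delta_mx k l).
Proof.
apply/matrixP => x y; case: (mxtens_indexP x) => a b; case: (mxtens_indexP y) => c d.
rewrite summxE (bigD1 a) //= summxE (bigD1 c) //= summxE (bigD1 b) //=.
rewrite summxE (bigD1 d) //= mxE tensmxE !mxE !eqxx !mulr1.
rewrite !big1 ?addr0 // => [i|i|i|i] /negPf ni; rewrite ?summxE.
- rewrite big1 // => j _; rewrite summxE big1 // => k _.
  rewrite summxE big1 // => l _.
  by rewrite mxE tensmxE !mxE eq_sym ni /= mul0r mulr0.
- rewrite big1 // => k _; rewrite summxE big1 // => l _.
  by rewrite mxE tensmxE !mxE [c == i]eq_sym ni andbF mul0r mulr0.
- rewrite big1 // => l _.
  by rewrite mxE tensmxE !mxE [b == i]eq_sym ni mulr0 mulr0.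
- by rewrite mxE tensmxE !mxE [d == i]eq_sym ni andbF mulr0 mulr0.
Qed.

Lemma tensmxDr m n p q (A : 'M[C]_(m, n)) (B B' : 'M[C]_(p, q)) :
  A *t (B + B') = A *t B + A *t B'.
Proof. by apply/matrixP => i j; rewrite !mxE mulrDr. Qed.

Lemma tensmapDr m m' p p' (E : 'M[C]_m -> 'M[C]_m')
    (F F' : 'M[C]_p -> 'M[C]_p') L :
  tensmap E (fun N => F N + F' N) L = tensmap E F L + tensmap E F' L.
Proof.
rewrite /tensmap -big_split; apply: eq_bigr => i _.
rewrite -big_split; apply: eq_bigr => j _.
rewrite -big_split; apply: eq_bigr => k _.
rewrite -big_split; apply: eq_bigr => l _.
by rewrite tensmxDr scalerDr.
Qed.

Lemma completely_positiveD m n (E F : 'M[C]_m -> 'M[C]_n) :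
  completely_positive E -> completely_positive F ->
  completely_positive (fun L => E L + F L).
Proof.
by move=> cE cF k L pL; rewrite tensmapDr; apply: psdD; [apply: cE|apply: cF].
Qed.

Lemma completely_positive_sum (I : Type) (r : seq I) m n
    (E : I -> 'M[C]_m -> 'M[C]_n) :
  (forall i, completely_positive (E i)) ->
  completely_positive (fun L => \sum_(i <- r) E i L).
Proof.
move=> cE; elim: r => [|i r IHr].
  move=> k L _; rewrite /tensmap big1 => [|i _]; first exact: psd0.
  rewrite big1 // => j _; rewrite big1 // => u _; rewrite big1 // => l _.
  by rewrite big_nil tensmx0 scaler0.
under [X in completely_positive X]eq_fun do rewrite big_cons.
exact: completely_positiveD.
Qed.

(** Tensoring with the identity map gives conjugation by [1%:M *t A], which preserves positivity. *)
Lemma completely_positive_conj m n (A : 'M[C]_(n, m)) :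
  completely_positive (fun L => A *m L *m A^t*).
Proof.
move=> k L pL; have := psd_conj (1%:M *t A) pL.
rewrite {1}(tensmx_sum_delta L) adjmx_tens trmx1 map_mx1 /tensmap.
rewrite mulmx_sumr mulmx_suml; congr psd; apply: eq_bigr => i _.
rewrite mulmx_sumr mulmx_suml; apply: eq_bigr => j _.
rewrite mulmx_sumr mulmx_suml; apply: eq_bigr => u _.
rewrite mulmx_sumr mulmx_suml; apply: eq_bigr => l _.
by rewrite -scalemxAr -scalemxAl !tensmx_mul mul1mx mulmx1.
Qed.

(** Kraus form of the map replacing a matrix by its trace times the identity: [|c><d| N |d><c|] is
    [N d d] times [|c><c|]. *)
Lemma scalemx_tr_delta n p (N : 'M[C]_n) :
  \tr N *: (1%:M : 'M[C]_p) =
  \sum_(c < p) \sum_(d < n) delta_mx c d *m N *m delta_mx d c.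
Proof.
rewrite mx1_sum_delta scaler_sumr; apply: eq_bigr => c _.
rewrite scaler_suml; apply: eq_bigr => d _.
rewrite -(mul_delta_mx (0 : 'I_1) c d) -(mul_delta_mx (0 : 'I_1) d c).
rewrite !mulmxA -(mulmxA _ _ N) -(mulmxA _ _ (delta_mx d 0)) -rowE -colE.
rewrite [col _ _]mx11_scalar !mxE.
by rewrite mul_mx_scalar -scalemxAl mul_delta_mx.
Qed.

(* The Kraus operators are [B *m |c><d| *m A], where [rho = B *m B^t*]. *)
Lemma completely_positive_prepare m n (A : 'M[C]_m) (rho : 'M[C]_n) :
  psd rho -> completely_positive (fun L => \tr (A *m L *m A^t*) *: rho).
Proof.
move=> /psd_factor[B ->].
pose K (c : 'I_n) (d : 'I_m) : 'M[C]_(n, m) := B *m delta_mx c d *m A.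
suff -> : (fun L => \tr (A *m L *m A^t*) *: (B *m B^t*)) =
          (fun L => \sum_c \sum_d K c d *m L *m (K c d)^t*).
  apply: completely_positive_sum => c; apply: completely_positive_sum => d.
  exact: completely_positive_conj.
apply/funext => L; rewrite /K -{1}[B]mulmx1 scalemxAl scalemxAr scalemx_tr_delta.
rewrite mulmx_sumr mulmx_suml; apply: eq_bigr => c _.
rewrite mulmx_sumr mulmx_suml; apply: eq_bigr => d _.
by rewrite !adjmxM trmx_delta map_delta_mx !mulmxA.
Qed.

(** [P] is the projector onto the support of [M]. It is a left multiple of [M], so it annihilates
    whatever [M] does. *)
Lemma psd_supp_proj n (M : 'M[C]_n) : psd M ->
  exists P : 'M[C]_n, [/\ P^t* = P, P *m P = P, P *m M = M
    & forall N : 'M[C]_n, M *m N = 0 -> P *m N = 0].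
Proof.
move=> /psd_spectral[Q [d [QQ QQ' -> d0]]].
(* [e] marks the nonzero eigenvalues, and [f] holds the pseudo-inverse spectrum, with the convention
   [0^-1 = 0]. *)
pose e : 'rV[C]_n := \row_i (d 0 i != 0)%:R.
pose f : 'rV[C]_n := \row_i (d 0 i)^-1.
have ee : diag_mx e *m diag_mx e = diag_mx e.
  rewrite mulmx_diag; congr diag_mx; apply/rowP => i.
  by rewrite !mxE -natrM mulnb andbb.
have ed : diag_mx e *m diag_mx d = diag_mx d.
  rewrite mulmx_diag; congr diag_mx; apply/rowP => i; rewrite !mxE.
  by case: eqP => [->|_]; rewrite ?mulr0 ?mul1r.
have fd : diag_mx f *m diag_mx d = diag_mx e.
  rewrite mulmx_diag; congr diag_mx; apply/rowP => i; rewrite !mxE.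
  by case: eqP => [->|/eqP d0']; rewrite ?mulr0 ?mulVf.
exists (Q^t* *m diag_mx e *m Q); split.
- rewrite !adjmxM trmxCK mulmxA; congr (_ *m _ *m _).
  rewrite tr_diag_mx map_diag_mx; congr diag_mx; apply/rowP => i.
  by rewrite !mxE rmorph_nat.
- rewrite !mulmxA -(mulmxA _ Q (Q^t*)) QQ mulmx1.
  by rewrite -(mulmxA _ (diag_mx e) (diag_mx e)) ee.
- rewrite !mulmxA -(mulmxA _ Q (Q^t*)) QQ mulmx1.
  by rewrite -(mulmxA _ (diag_mx e) (diag_mx d)) ed.
- move=> N /(congr1 (mulmx (Q^t* *m diag_mx f *m Q))).
  rewrite mulmx0 !mulmxA -(mulmxA _ Q (Q^t*)) QQ mulmx1.
  by rewrite -(mulmxA _ (diag_mx f) (diag_mx d)) fd.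
Qed.

(** Measure the support projector of [rho0] against its complement, then prepare [rho] or [sigma];
    by orthogonality the outcome is certain on both inputs. *)
Lemma orthogonal_states_channel m n (rho0 sigma0 : 'M[C]_m) (rho sigma : 'M[C]_n) :
  orthogonal_states rho0 sigma0 -> state rho -> state sigma ->
  exists E : 'M[C]_m -> 'M[C]_n, [/\ cptp E, E rho0 = rho & E sigma0 = sigma].
Proof.
move=> [[p0 t0] [q0 s0] os] [pr tr1] [ps ts1].
have [P [Padj PP Prho Psigma]] := psd_supp_proj p0.
have Ps := Psigma _ os.
pose Q := 1%:M - P.
have Qadj : Q^t* = Q by rewrite /Q raddfB /= map_mxB trmx1 map_mx1 Padj.
have QQ : Q *m Q = Q.
  by rewrite /Q mulmxBl mul1mx mulmxBr mulmx1 PP subrr subr0.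
(* The sandwiched form is the one known to be completely positive; cyclicity gives the simpler form
   used for linearity and traces. *)
have trP (A L : 'M[C]_m) : A^t* = A -> A *m A = A ->
    \tr (A *m L *m A^t*) = \tr (A *m L).
  by move=> aA AA; rewrite mxtrace_mulC aA mulmxA AA.
exists (fun L => \tr (P *m L *m P^t*) *: rho + \tr (Q *m L *m Q^t*) *: sigma).
split; [split| |].
- move=> a L L'; rewrite !trP //.
  rewrite !mulmxDr -!scalemxAr !mxtraceD !mxtraceZ !scalerDl !scalerDr !scalerA.
  by rewrite addrACA.
- by apply: completely_positiveD; apply: completely_positive_prepare.
- move=> L; rewrite !trP // mxtraceD !mxtraceZ tr1 ts1 !mulr1 -mxtraceD.
  by rewrite -mulmxDl addrC subrK mul1mx.
- by rewrite !trP // mulmxBl mul1mx Prho subrr t0 mxtrace0 scale0r addr0 scale1r.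
- by rewrite !trP // mulmxBl mul1mx Ps subr0 s0 mxtrace0 scale0r add0r scale1r.
Qed.

(** Complete positivity with a one-dimensional ancilla is ordinary positivity, up to the
    identification of [1%:M *t L] with [L]. *)
Lemma cp_psd m n (E : 'M[C]_m -> 'M[C]_n) (L : 'M[C]_m) :
  linear E -> completely_positive E -> psd L -> psd (E L).
Proof.
move=> linE cE pL; have := cE 1%N _ (psd_tens (@psd1 1) pL).
have -> : tensmap (fun N : 'M[C]_1 => N) E (1%:M *t L) = 1%:M *t E L.
  have EL : E L = \sum_k \sum_l L k l *: E (delta_mx k l).
    rewrite {1}(matrix_sum_delta L) pair_bigA linear_sumZ // pair_bigA.
    by apply: eq_bigr => -[].
  rewrite /tensmap big_ord1 big_ord1.
  apply/matrixP => x y; case: (mxtens_indexP x) => a b.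
  case: (mxtens_indexP y) => c d; rewrite tensmxE EL !ord1.
  rewrite !mxE mul1r !summxE; apply: eq_bigr => k _.
  rewrite !summxE; apply: eq_bigr => l _.
  by rewrite [in RHS]mxE mxE !tensmxE !mxE !eqxx !mul1r.
(* Compressing [1%:M *t E L] by [1%:M *t v^t*] leaves a single entry, the quadratic form of [E L] at
   [v]. *)
move=> pEL v.
have := psd_diag_ge0 (mxtens_index (0, 0)) (psd_conj ((1%:M : 'M[C]_1) *t v^t*) pEL).
rewrite adjmx_tens !tensmx_mul tensmxE trmxCK !mul1mx trmx1 map_mx1.
by rewrite mxE mul1r.
Qed.

End PsdMatrices.

(** * Operators on composite systems and convex combinations of free operations *)

Section Systems.
Variables (R : realType) (S : systems).
Local Notation C := R[i].

(** Composite dimensions equal products only up to a propositional equality, so operators are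
    transported along it; eliminating the equality makes the cast trivial. *)
Lemma castmx_sqM m n (e : m = n) (A B : 'M[C]_m) :
  castmx (e, e) (A *m B) = castmx (e, e) A *m castmx (e, e) B.
Proof. by case: n / e; rewrite !castmx_id. Qed.

Lemma castmx_sq_adj m n (e : m = n) (A : 'M[C]_m) :
  (castmx (e, e) A)^t* = castmx (e, e) (A^t*).
Proof. by case: n / e; rewrite !castmx_id. Qed.

Lemma castmx_sq_tr m n (e : m = n) (A : 'M[C]_m) : \tr (castmx (e, e) A) = \tr A.
Proof. by case: n / e; rewrite castmx_id. Qed.

Lemma castmx_sq_psd m n (e : m = n) (A : 'M[C]_m) : psd A -> psd (castmx (e, e) A).
Proof. by case: n / e; rewrite castmx_id. Qed.

Lemma tensM (A B : S) (M M' : op R A) (N N' : op R B) :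
  tens M N *m tens M' N' = tens (M *m M') (N *m N').
Proof. by rewrite /tens /of_tens -castmx_sqM tensmx_mul. Qed.

Lemma adj_tens (A B : S) (M : op R A) (N : op R B) :
  (tens M N)^t* = tens (M^t*) (N^t*).
Proof. by rewrite /tens /of_tens castmx_sq_adj adjmx_tens. Qed.

Lemma ptr1_tens (A B : S) (M : op R A) (N : op R B) : ptr1 (tens M N) = \tr M *: N.
Proof.
rewrite /ptr1 /to_tens /tens /of_tens castmxKV; apply/matrixP => i j.
by rewrite !mxE mulr_suml; apply: eq_bigr => k _; rewrite tensmxE.
Qed.

Lemma tr_tens m n (M : 'M[C]_m) (N : 'M[C]_n) : \tr (M *t N) = \tr M * \tr N.
Proof. by rewrite mulr_sum; apply: eq_bigr => i _; rewrite mxE. Qed.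

Lemma state_tens (A B : S) (M : op R A) (N : op R B) :
  state M -> state N -> state (tens M N).
Proof.
move=> [pM tM] [pN tN]; split; first exact/castmx_sq_psd/psd_tens.
by rewrite castmx_sq_tr tr_tens tM tN mulr1.
Qed.

Lemma cptp_state m n (E : 'M[C]_m -> 'M[C]_n) rho :
  cptp E -> state rho -> state (E rho).
Proof.
by move=> [lE cE tE] [pr tr]; split; [exact: cp_psd|rewrite tE].
Qed.

(** On a product input the measurement decouples: each branch is weighted by the probability of its
    outcome on [rho]. *)
Lemma controlled_tens (A X Y : S) (I : finType) (X0 : {set I}) (M : I -> op R A)
    (E : I -> op R X -> op R Y) (Ebot : op R X -> op R Y)
    (M' rho : op R A) (chi : op R X) :
  (forall x, x \in X0 -> linear (E x)) -> linear Ebot ->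
  \sum_(x in X0) E x (ptr1 (tens (M x) 1%:M *m tens rho chi)) +
    Ebot (ptr1 (tens M' 1%:M *m tens rho chi)) =
  \sum_(x in X0) \tr (M x *m rho) *: E x chi + \tr (M' *m rho) *: Ebot chi.
Proof.
move=> linE linEbot; rewrite tensM ptr1_tens mul1mx linear_scale //.
congr (_ + _); apply: eq_bigr => x xX0.
by rewrite tensM ptr1_tens mul1mx linear_scale //; apply: linE.
Qed.

(** Binary convexity suffices by induction: an average of n + 1 terms gives weight 1/(n + 1) to the
    head and n/(n + 1) to the average of the tail. *)
Lemma free_op_average (T : resource_theory R S) (X Y : S) (I : eqType)
    (s : seq I) (E : I -> op R X -> op R Y) :
  convex_free_op T -> s != [::] -> (forall i, i \in s -> free_op T X Y (E i)) ->
  free_op T X Y (fun L => (size s)%:R^-1 *: \sum_(i <- s) E i L).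
Proof.
move=> cvx; elim: s => //= i [|j s] IHs _ Efree.
  under eq_fun do rewrite big_seq1 invr1 scale1r.
  by apply: Efree; rewrite inE.
have {}IHs := IHs isT (fun k ks => Efree k (mem_behead (s := i :: j :: s) ks)).
set n := size (j :: s) in IHs *.
have n1 : (n.+1%:R : R) != 0 by rewrite pnatr_eq0.
have t01 : 0 <= (n.+1%:R^-1 : R) <= 1.
  by rewrite invr_ge0 ler0n invf_le1 ?ltr0n // ler1n.
suff -> : (fun L => n.+1%:R^-1 *: \sum_(k <- [:: i, j & s]) E k L) =
    (fun L => (n.+1%:R^-1 : R)%:C *: E i L +
       (1 - n.+1%:R^-1 : R)%:C *: (n%:R^-1 *: \sum_(k <- j :: s) E k L)).
  by apply: cvx => //; apply: Efree; rewrite mem_head.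
apply/funext => L.
rewrite [in LHS]big_cons scalerDr scalerA; congr (_ *: _ + _ *: _).
  by rewrite rmorphV ?unitfE //= rmorph_nat.
have -> : 1 - n.+1%:R^-1 = n%:R / n.+1%:R :> R.
  by rewrite -[n.+1]addn1 natrD in n1 *; field.
rewrite rmorphM rmorphV ?unitfE //= !rmorph_nat mulrAC divff ?mul1r //.
by rewrite pnatr_eq0.
Qed.

(** * The group action, covariance and twirling *)

Section Symmetry.
Variables (gT : finGroupType) (G : {group gT}) (U : projective_symmetry R S G).

Lemma sym_act_linear (A : S) g : linear (sym_act U (A := A) g).
Proof.
by move=> a L L'; rewrite /sym_act mulmxDr mulmxDl -scalemxAr -scalemxAl.
Qed.

HB.instance Definition _ (A : S) (g : gT) :=
  GRing.isLinear.Build C (op R A) (op R A) *:%R (sym_act U g) (@sym_act_linear A g).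

(** The projective phase [w] meets its conjugate, and their product is 1. *)
Lemma sym_actM (A : S) g h (L : op R A) : g \in G -> h \in G ->
  sym_act U g (sym_act U h L) = sym_act U (g * h)%g L.
Proof.
move=> gG hG; have [w w1 wE] := rep_projective U A gG hG.
rewrite /sym_act !mulmxA -mulmxA -adjmxM wE -scalemxAl.
rewrite linearZ /= map_mxZ -scalemxAr -scalemxAl scalerA mulrC.
by rewrite -normCK w1 expr1n scale1r.
Qed.

(** The representation need not send 1 to the identity matrix. Its action is however idempotent by
    [sym_actM] and injective by unitarity, hence the identity. *)
Lemma sym_act1 (A : S) (L : op R A) : sym_act U 1 L = L.
Proof.
have /unitarymxP uV := rep_unitary U A (group1 G).
have uV' := mulmx1C uV.
have inj1 : injective (@sym_act R S gT G U A 1).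
  apply: (can_inj (g := fun N => (rep U A 1%g)^t* *m N *m rep U A 1%g)) => N.
  by rewrite /sym_act -!mulmxA uV' mulmx1 mulmxA uV' mul1mx.
by apply: inj1; rewrite sym_actM ?mulg1 ?group1.
Qed.

Lemma sym_actKV (A : S) g (L : op R A) : g \in G ->
  sym_act U g (sym_act U g^-1%g L) = L.
Proof. by move=> gG; rewrite sym_actM ?groupV // mulgV sym_act1. Qed.

Lemma sym_act_tens (A B : S) g (M : op R A) (N : op R B) : g \in G ->
  sym_act U g (tens M N) = tens (sym_act U g M) (sym_act U g N).
Proof. by move=> gG; rewrite /sym_act rep_composite // adj_tens !tensM. Qed.

Lemma sym_act_psd (A : S) g (L : op R A) : psd L -> psd (sym_act U g L).
Proof. exact: psd_conj. Qed.

(** Writing [h = g * k], the factors [g] cancel and only conjugation by [k] in [K] remains, which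
    fixes [E]. Hence any representative of the correct coset recovers [E]. *)
Lemma covariant_lcoset (K : {group gT}) (A B : S) (E : op R A -> op R B) g h
    (L : op R A) :
  K \subset G -> covariant U K E -> g \in G -> h \in (g *: K)%g ->
  sym_act U g^-1%g (sym_act U h (E (sym_act U h^-1%g (sym_act U g L)))) = E L.
Proof.
move=> sKG covE gG /lcosetP[k kK ->]; have kG := fintype.subsetP sKG k kK.
rewrite sym_actM ?groupV ?groupM // mulKg sym_actM ?groupV ?groupM //.
rewrite invMg mulgKV; have /(congr1 (fun f => f L)) /= -> := covE _ (groupVr kK).
exact: sym_actKV.
Qed.

Lemma free_op_sym_conj (T : resource_theory R S) (A B : S) (E : op R A -> op R B) g :
  compatible T U -> g \in G -> free_op T A B E ->
  free_op T A B (fun L => sym_act U g (E (sym_act U g^-1%g L))).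
Proof. by move=> /(_ g) TU gG fE; have [_ /(_ A B) <-] := TU gG; exists E. Qed.

(** Reindexing the sum by right translation [g * h] moves the action of [h] from the output to the
    input. *)
Lemma covariant_twirl (A B : S) (E : op R A -> op R B) (a : C) :
  covariant U G
    (fun L => a *: \sum_(g in G) sym_act U g^-1%g (E (sym_act U g L))).
Proof.
move=> h hG; apply/funext => L /=.
rewrite [RHS]linearZ /=; congr (_ *: _); rewrite linear_sum /=.
rewrite [RHS](reindex_inj (mulIg h)) /=.
apply: eq_big => [g|g gG]; first by rewrite groupMr.
by rewrite !sym_actM ?groupV ?groupM // invMg mulKVg.
Qed.

End Symmetry.

End Systems.

(** * From operator domination to the bound on the distinguishability measure *)

(** Domination [(1 - epsilon) rho <= sigma] makes [sigma] a mixture of [rho] and a remainder state,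
    which is the image of the mixture of [rho0] and [sigma0] under one channel. *)
Lemma Delta_mixture_le (R : realType)
    (Delta : forall n, 'M[R[i]]_n -> 'M[R[i]]_n -> \bar R)
    m n (rho0 sigma0 : 'M[R[i]]_m) (rho sigma : 'M[R[i]]_n) (epsilon : R) :
  distinguishability_measure Delta -> orthogonal_states rho0 sigma0 ->
  0 <= epsilon < 1 -> state rho -> state sigma ->
  psd (sigma - (1 - epsilon)%:C *: rho) ->
  (Delta n rho sigma <= orth_dist Delta rho0 sigma0 (- ln (1 - epsilon))%:E)%E.
Proof.
move=> [_ Dmono] orth /andP[e0 e1] rhoS sigmaS pD.
set D := sigma - _ in pD.
have trD : \tr D = epsilon%:C.
  rewrite /D mxtraceD raddfN /= mxtraceZ (proj2 rhoS) (proj2 sigmaS) mulr1.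
  by rewrite rmorphB rmorph1 opprB addrC subrK.
have [tau tauS DE] : exists2 tau, state tau & D = epsilon%:C *: tau.
  (* The remainder has trace [epsilon]. If that is 0 the remainder vanishes and any state serves as
     [tau]; otherwise it is normalized. *)
  have [e_eq0|e_neq0] := eqVneq epsilon 0.
    exists rho => //; rewrite e_eq0 scale0r.
    by apply: psd_tr0 => //; rewrite trD e_eq0.
  have eC : epsilon%:C != 0 :> R[i] by rewrite fmorph_eq0.
  exists (epsilon%:C^-1 *: D); last by rewrite scalerA divff // scale1r.
  split; last by rewrite mxtraceZ trD mulVf.
  by apply: psdZ => //; rewrite invr_ge0 lecR.
have [E [cptpE Erho Etau]] := orthogonal_states_channel orth rhoS tauS.
have [lE _ _] := cptpE.
have [s0 t0 _] := orth.
have expE : fine (expeR (- (- ln (1 - epsilon))%:E)) = 1 - epsilon.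
  by rewrite -EFinN opprK /= lnK // posrE subr_gt0.
rewrite /orth_dist expE.
have sE : sigma = (1 - epsilon)%:C *: rho + epsilon%:C *: tau.
  by rewrite -DE /D addrC subrK.
have eE : 1 - (1 - epsilon)%:C = epsilon%:C :> R[i].
  by rewrite rmorphB rmorph1 opprB addrC subrK.
have mixS : state ((1 - epsilon)%:C *: rho0 + epsilon%:C *: sigma0).
  split; last first.
    rewrite mxtraceD !mxtraceZ (proj2 s0) (proj2 t0) !mulr1.
    by rewrite rmorphB rmorph1 subrK.
  apply: psdD; (apply: psdZ; first by rewrite lecR ?subr_ge0 // ltW).
    exact: (proj1 s0).
  exact: (proj1 t0).
rewrite eE -Erho sE -Erho -Etau -(linear_scale lE epsilon%:C) -lE.
exact: Dmono.
Qed.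

(** * The controlled operation, its twirl and the success probability *)

Theorem theorem3 (R : realType) (S : systems) (T : resource_theory R S)
  (gT : finGroupType) (G K : {group gT}) (U : projective_symmetry R S G)
  (T_tensor : tensor_closed T) (T_ancilla : ancilla_preparation T)
  (T_discard : closed_under_discarding T) (T_convex : convex_free_op T)
  (TU_compatible : compatible T U)
  (sKG : K \subset G)
  (epsilon : R) (epsilon_bounds : 0 <= epsilon < 1)
  (A : S) (rho : op R A) (rho_state : state rho)
  (M_exists : exists M : {set gT} -> op R A,
     [/\ sub_povm (lcosets K G) M,
         control_admissible T (lcosets K G) M
       & (1 - epsilon)%:C <=
         #|G|%:R^-1 * \sum_(g in G) \tr (M (g *: K)%g *m sym_act U g rho)])
  (X Y : S) (E : op R X -> op R Y)
  (E_free : free_op T X Y E) (E_covariant : covariant U K E)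
  (Delta : forall n, 'M[R[i]]_n -> 'M[R[i]]_n -> \bar R)
  (Delta_dist : distinguishability_measure Delta)
  (n : nat) (rho0 sigma0 : 'M[R[i]]_n)
  (orth : orthogonal_states rho0 sigma0) :
  exists F : op R (composite A X) -> op R Y,
    [/\ free_op T (composite A X) Y F,
        covariant U G F
      & forall chi : op R X, state chi ->
          (Delta (hdim Y) (E chi) (F (tens rho chi)) <=
             orth_dist Delta rho0 sigma0 (- ln (1 - epsilon))%:E)%E].
Proof.
have [M [[psdM psdMbot] admM guess]] := M_exists.
pose Ex (x : {set gT}) (L : op R X) :=
  sym_act U (repr x) (E (sym_act U (repr x)^-1%g L)).
have repr_lcoset g : repr (g *: K)%g \in (g *: K)%g.
  exact: mem_repr (lcoset_refl K g).
have repr_G x : x \in lcosets K G -> repr x \in G.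
  move=> /lcosetsP[g gG ->]; have /lcosetP[k kK ->] := repr_lcoset g.
  by rewrite groupM // (fintype.subsetP sKG).
have Ex_free x : x \in lcosets K G -> free_op T X Y (Ex x).
  by move=> /repr_G xG; apply: free_op_sym_conj.
have linEx x : x \in lcosets K G -> linear (Ex x).
  by move=> /Ex_free /free_opP[].
have [linE _ _] := free_opP E_free.
(* The inconclusive outcome also needs a free operation. [E] is a convenient choice: the estimate
   below uses only that this branch is positive. *)
have := admM X Y Ex E Ex_free E_free; set F0 := (F0 in free_op T _ _ F0) => F0_free.
pose F L := #|G|%:R^-1 *: \sum_(g in G) sym_act U g^-1%g (F0 (sym_act U g L)).
have F_free : free_op T (composite A X) Y F.
  have := @free_op_average R S T (composite A X) Y gT (enum G)
    (fun g L => sym_act U g^-1%g (F0 (sym_act U g L))) T_convex.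
  under [X in _ -> _ -> free_op _ _ _ X]eq_fun do rewrite big_enum -cardE.
  apply.
    by rewrite -size_eq0 -cardE -lt0n cardG_gt0.
  move=> g; rewrite mem_enum => gG.
  have := free_op_sym_conj TU_compatible (groupVr gG) F0_free.
  by rewrite invgK.
exists F; split=> // [|chi chiS]; first exact: covariant_twirl.
have EchiS := cptp_state (free_opP E_free) chiS.
apply: Delta_mixture_le => //.
  exact: cptp_state (free_opP F_free) (state_tens rho_state chiS).
pose p g := \tr (M (g *: K)%g *m sym_act U g rho).
have trM_ge0 (N : op R A) g : psd N -> 0 <= \tr (N *m sym_act U g rho).
  move=> pN; apply: psd_trM_ge0 => //.
  by apply: sym_act_psd; exact: (proj1 rho_state).
(* For each [g], the branch of the correct outcome [gK] contributes exactly [p g *: E chi]; all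
   other branches, including the inconclusive one, are psd and form the excess. *)
have twirled g : g \in G ->
    psd (sym_act U g^-1%g (F0 (sym_act U g (tens rho chi))) - p g *: E chi).
  move=> gG; have gK : (g *: K)%g \in lcosets K G by apply/lcosetsP; exists g.
  rewrite sym_act_tens // /F0 controlled_tens // (bigD1 (g *: K)%g) //=.
  rewrite !linearD /= linearZ /= (covariant_lcoset _ sKG) // -/(p g).
  rewrite [X in psd X]addrC addrA addKr.
  have psdE L : psd L -> psd (E L) by have [? ? _] := free_opP E_free; apply: cp_psd.
  have psdEx x : x \in lcosets K G -> psd (Ex x (sym_act U g chi)).
    move=> /Ex_free /free_opP[? ? _]; apply: cp_psd => //.
    by apply: sym_act_psd; exact: (proj1 chiS).
  apply: psdD; apply: sym_act_psd.
    apply: psd_sum => x /andP[xX0 _].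
    by apply: psdZ; [apply: trM_ge0; apply: psdM|apply: psdEx].
  apply: psdZ; first exact: trM_ge0.
  by apply: psdE; apply: sym_act_psd; exact: (proj1 chiS).
(* The difference splits into the average of these excesses and a multiple of [E chi] whose
   coefficient, the mean success probability minus [1 - epsilon], is nonnegative by [guess]. *)
have -> : F (tens rho chi) - (1 - epsilon)%:C *: E chi =
    #|G|%:R^-1 *: (\sum_(g in G)
      (sym_act U g^-1%g (F0 (sym_act U g (tens rho chi))) - p g *: E chi)) +
    (#|G|%:R^-1 * \sum_(g in G) p g - (1 - epsilon)%:C) *: E chi.
  rewrite sumrB -scaler_suml scalerBr scalerA scalerBl addrA.
  by rewrite subrK.
apply: psdD.
  by apply: psdZ; [rewrite invr_ge0 ler0n|apply: psd_sum].
by apply: psdZ; [rewrite subr_ge0|exact: (proj1 EchiS)].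
Qed.
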